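(* Let $d,m\ge1$ be integers, $X=\mathbf{R}^d$, $Y=\mathbf{R}^m$, and let $A=(A_{n,k}:n,k\in\omega)$ be an infinite matrix of bounded linear operators in $\mathcal{B}(X,Y)$. Fix $T\in\mathcal{B}(X,Y)$, an injection $\sigma:\omega\to\omega$ without periodic points, and let $\mathcal{I},\mathcal{J}$ be ideals on $\omega$ with $\mathcal{J}$ countably generated. Represent each $A_{n,k}$ by the real matrix $[a_{n,k}(i,j):1\le i\le m,1\le j\le d]$ and $T$ by $[t(i,j):1\le i\le m,1\le j\le d]$. Then $A$ is $(\mathcal{I},\mathcal{J},\sigma)$-almost regular with respect to $T$ if and only if all of the following hold: (K1) $\sup_n\sum_k\sum_{i,j}|a_{n,k}(i,j)|<\infty$; (K2) $(\mathcal{J},\sigma)\text{-}\lim_n\sum_ka_{n,k}(i,j)=t(i,j)$, for all $1\le i\le m$ and $1\le j\le d$; (K3) $(\mathcal{J},\sigma)\text{-}\lim_n\sum_{k\in E}a_{n,k}(i,j)=0$, for all $1\le i\le m$, $1\le j\le d$, and $E\in\mathcal{I}$.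
   Context: $\omega=\{0,1,2,\ldots\}$. $\mathcal{B}(X,Y)$ is the space of (bounded) linear operators $X\to Y$. A map $\sigma:\omega\to\omega$ is without periodic points if $\sigma^{p+1}(n)\neq n$ for all $n,p\in\omega$ (iterates of $\sigma$). An ideal on $\omega$ is a family $\mathcal{I}$ of subsets of $\omega$ closed under finite unions and subsets; it is always assumed that $\omega\notin\mathcal{I}$ and that $\mathcal{I}$ contains all finite subsets of $\omega$. $\mathcal{I}^\star:=\{\omega\setminus S:S\in\mathcal{I}\}$. $\mathcal{I}$ is countably generated if there is a sequence $(S_n)_{n\in\omega}$ in $\mathcal{I}$ such that for all $S\subseteq\omega$: $S\in\mathcal{I}$ iff $S\subseteq\bigcup_{n\in F}S_n$ for some finite $F\subseteq\omega$. A sequence $(x_n)$ is $\mathcal{I}$-convergent to $\eta$ ($\mathcal{I}\text{-}\lim\bm{x}=\eta$) if $\{n:x_n\notin U\}\in\mathcal{I}$ for every neighborhood $U$ of $\eta$. For a Banach space $Z$, a sequence $\bm{z}=(z_n)\in Z^\omega$ and $n,\nu\in\omega$, put $F^{\sigma,\nu}_n\bm{z}:=\frac{1}{n+1}\sum_{i=0}^nz_{\sigma(\nu+i)}$. The sequence $\bm{z}$ is $(\mathcal{J},\sigma)$-convergent to $\eta\in Z$, written $(\mathcal{J},\sigma)\text{-}\lim\bm{z}=\eta$ (or $(\mathcal{J},\sigma)\text{-}\lim_nz_n=\eta$), if for every neighborhood $U$ of $\eta$ there is $S\in\mathcal{J}^\star$ such that $F^{\sigma,\nu}_n\bm{z}\in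 U$ for all $n\in S$ and all $\nu\in\omega$. $V_{\mathcal{J},\sigma}(Z)$ is the space of bounded $(\mathcal{J},\sigma)$-convergent sequences in $Z$. For a matrix $A=(A_{n,k})$ of linear operators from $X$ to $Y$, $\mathrm{dom}(A)$ is the set of $\bm{x}=(x_k)\in X^\omega$ such that $\sum_kA_{n,k}x_k$ converges for every $n$; then $A_n\bm{x}:=\sum_kA_{n,k}x_k$ and $A\bm{x}:=(A_n\bm{x}:n\in\omega)$. $c^b(X,\mathcal{I})$ is the space of bounded $\mathcal{I}$-convergent sequences in $X$. $A$ is $(\mathcal{I},\mathcal{J},\sigma)$-almost regular with respect to $T$ if $c^b(X,\mathcal{I})\subseteq\mathrm{dom}(A)$ and, for all $\bm{x}\in c^b(X,\mathcal{I})$, $A\bm{x}\in V_{\mathcal{J},\sigma}(Y)$ and $(\mathcal{J},\sigma)\text{-}\lim A\bm{x}=T(\mathcal{I}\text{-}\lim\bm{x})$. *)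

(* Defs.v *)
From mathcomp Require Export all_boot all_order all_algebra.
From mathcomp Require Export all_classical all_reals all_analysis.

Set Implicit Arguments.
Unset Strict Implicit.
Unset Printing Implicit Defensive.

Export Order.TTheory GRing.Theory Num.Theory.
Export numFieldNormedType.Exports.

Local Open Scope classical_set_scope.
Local Open Scope ring_scope.

Definition without_periodic_points (sigma : nat -> nat) : Prop :=
  forall n p : nat, iter p.+1 sigma n <> n.

Record is_ideal (I : set (set nat)) : Prop := IsIdeal {
  ideal_setU : forall A B : set nat, I A -> I B -> I (A `|` B);
  ideal_subset : forall A B : set nat, A `<=` B -> I B -> I A;
  ideal_proper : ~ I setT;
  ideal_finite : forall A : set nat, finite_set A -> I A
}.

Definition dual_filter (I : set (set nat)) : set (set nat) :=
  [set ~` S | S in I].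

Definition countably_generated (I : set (set nat)) : Prop :=
  exists S : nat -> set nat, (forall n, I (S n)) /\
    forall B : set nat,
      I B <-> exists2 F : set nat, finite_set F & B `<=` \bigcup_(n in F) S n.

Section Convergence.
Context {R : realType} {Z : normedModType R}.
Implicit Types (I J : set (set nat)) (z : nat -> Z) (eta : Z).

Definition ideal_cvg I z eta : Prop :=
  forall U : set Z, nbhs eta U -> I [set n | ~ U (z n)].

(* c^b(Z, I) *)
Definition bounded_ideal_cvg_seq I : set (nat -> Z) :=
  [set z | bounded_fun z /\ exists eta, ideal_cvg I z eta].

(* F^{sigma,nu}_n z *)
Definition shifted_mean (sigma : nat -> nat) (nu n : nat) z : Z :=
  n.+1%:R^-1 *: \sum_(0 <= i < n.+1) z (sigma (nu + i)%N).

Definition almost_cvg J (sigma : nat -> nat) z eta : Prop :=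
  forall U : set Z, nbhs eta U ->
    exists2 S, dual_filter J S &
      forall n, S n -> forall nu, U (shifted_mean sigma nu n z).

(* V_{J,sigma}(Z) *)
Definition bounded_almost_cvg_seq J (sigma : nat -> nat) : set (nat -> Z) :=
  [set z | bounded_fun z /\ exists eta, almost_cvg J sigma z eta].

End Convergence.

Section OperatorMatrix.
Context {R : realType} {X Y : normedModType R}.
Implicit Types (A : nat -> nat -> {linear X -> Y}) (x : nat -> X).

Definition opmx_dom A : set (nat -> X) :=
  [set x | forall n, cvgn (series (fun k => A n k (x k)))].

(* Only meaningful for [x] in [opmx_dom A]. *)
Definition opmx_apply A x : nat -> Y :=
  fun n => limn (series (fun k => A n k (x k))).

(* Ideal limits are unique because ideals are proper, so quantifying over every
   limit [eta] of [x] amounts to speaking of the limit of [x]. *)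
Definition almost_regular (I J : set (set nat)) (sigma : nat -> nat)
    A (T : {linear X -> Y}) : Prop :=
  bounded_ideal_cvg_seq I `<=` opmx_dom A /\
  forall x, bounded_ideal_cvg_seq I x ->
    bounded_almost_cvg_seq J sigma (opmx_apply A x) /\
    forall eta, ideal_cvg I x eta ->
      almost_cvg J sigma (opmx_apply A x) (T eta).

End OperatorMatrix.

(* Main.v *)
Require Import Defs.
From mathcomp Require Import ring lra.

(** Everything reduces to the scalar rows k |-> a_{n,k}(i,j).

    Sufficiency: after subtracting the limit (handled by K2), let y be bounded
    and I-null. Up to a uniform error, y is supported on some E in I and is a
    finite combination of indicators of subsets of E, which also lie in I; K3
    applies to these, and K1 turns uniform errors on y into uniform errors on
    the row sums.

    Necessity: K2 and K3 come from constant and indicator sequences. Since I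
    contains the finite sets, K1 is the uniform boundedness principle on c_0,
    proved in the style of Sokal: if the l^1 norms of the rows T_j grow fast
    enough, put x_{j+1} = x_j +- 3^-j s_j with s_j a finite sign pattern nearly
    norming T_j, the sign being chosen so that |T_j x_{j+1}| >= 3^-j T_j s_j;
    the remaining increments have total size at most 3^-j / 2 and cannot
    compensate this. *)

Local Open Scope classical_set_scope.
Local Open Scope ring_scope.

(** * Real rows paired with bounded sequences, up to uniform boundedness on [c_0] *)

Section ScalarRows.
Set Implicit Arguments.
Unset Strict Implicit.
Context {R : realType}.
Implicit Types (r y z : nat -> R) (M C : R).

(** This is the pairing of l^1 with bounded sequences. [limn] returns a default value on divergent
    series, so most uses come with an [abs_sum_le] bound, finite support or a separate convergence
    statement. *)
Definition row_sum r y : R := limn (fun N => \sum_(0 <= k < N) r k * y k).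

(** The l^1 norm is bounded through partial sums, so that summability is a consequence and not a
    prerequisite of the statement. *)
Definition abs_sum_le M r := forall N, \sum_(0 <= k < N) `|r k| <= M.

Lemma abs_sum_le_ge0 M r : abs_sum_le M r -> 0 <= M.
Proof. by move=> /(_ 0%N); rewrite big_geq. Qed.

Lemma is_cvg_abs_sum M r :
  abs_sum_le M r -> cvgn (fun N => \sum_(0 <= k < N) `|r k|).
Proof.
move=> hM; apply: nondecreasing_is_cvgn.
  by apply/nondecreasing_seqP => n; rewrite big_nat_recr//= lerDl.
by exists M => _ [n _ <-].
Qed.

Lemma is_cvg_row M C r y : abs_sum_le M r -> (forall k, `|y k| <= C) ->
  cvgn (fun N => \sum_(0 <= k < N) r k * y k).
Proof.
move=> hM hC; apply: (@normed_cvg R R^o (fun k => r k * y k)).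
apply: (@is_cvg_abs_sum (M * C)) => N.
apply: (@le_trans _ _ (\sum_(0 <= k < N) `|r k| * C)).
  by apply: ler_sum => k _; rewrite normrM ler_wpM2l.
rewrite -mulr_suml ler_wpM2r//.
exact: le_trans (hC 0%N).
Qed.

Lemma row_sum_le M C r y : abs_sum_le M r -> (forall k, `|y k| <= C) ->
  `|row_sum r y| <= M * C.
Proof.
move=> hM hC; have C0 : 0 <= C by apply: le_trans (hC 0%N).
have cr := is_cvg_row hM hC.
have /cvg_lim <- // : `|\sum_(0 <= k < N) r k * y k| @[N --> \oo] --> `|row_sum r y|.
  exact: cvg_norm.
apply: limr_le; first exact: is_cvg_norm.
apply: nearW => N; apply: le_trans (ler_norm_sum _ _ _) _.
apply: (@le_trans _ _ (\sum_(0 <= k < N) `|r k| * C)).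
  by apply: ler_sum => k _; rewrite normrM ler_wpM2l.
by rewrite -mulr_suml ler_wpM2r.
Qed.

Lemma row_sum_linear M r y z (c : R) : abs_sum_le M r ->
  (exists C : R, forall k, `|y k| <= C) -> (exists C, forall k, `|z k| <= C) ->
  row_sum r (fun k => c * y k + z k) = c * row_sum r y + row_sum r z.
Proof.
move=> hM [C hC] [D hD]; apply: cvg_lim => //.
have -> : (fun N => \sum_(0 <= k < N) r k * (c * y k + z k)) =
    (fun N => c * (\sum_(0 <= k < N) r k * y k) + \sum_(0 <= k < N) r k * z k).
  apply: funext => N; rewrite mulr_sumr -big_split/=.
  by apply: eq_bigr => k _; rewrite mulrDr mulrCA.
apply: cvgD; last exact: is_cvg_row hM hD.
apply: cvgM; first exact: cvg_cst.
exact: is_cvg_row hM hC.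
Qed.

Lemma row_sum_finite r y N : (forall k, (N <= k)%N -> r k * y k = 0) ->
  row_sum r y = \sum_(0 <= k < N) r k * y k.
Proof.
move=> h; apply: cvg_lim => //; apply: cvg_near_cst.
near=> n; have leNn : (N <= n)%N by near: n; exact: nbhs_infty_ge.
rewrite (@big_cat_nat _ _ _ N)//= [X in _ + X]big_nat [X in _ + X]big1 ?addr0//.
by move=> k /andP[Nk _]; exact: h.
Unshelve. all: by end_near. Qed.

(** The factor 3/2 is the sum of the geometric series of ratio 1/3. This tail estimate controls all
    the increments that follow a given stage of the sliding construction below. *)
Lemma third_geometric_cvg (u : nat -> R) (hu : forall j, `|u j| <= 3^-1 ^+ j) :
  cvgn (series u) /\
  forall J, `|limn (series u) - series u J| <= 3 / 2 * 3^-1 ^+ J.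
Proof.
have cu : cvgn (series u).
  apply: normed_cvg; apply: (@series_le_cvg _ _ (geometric 1 3^-1)).
  - by move=> n; rewrite normr_ge0.
  - by move=> n; rewrite /geometric /= mul1r exprn_ge0.
  - by move=> n; rewrite /geometric /= mul1r.
  - by apply: is_cvg_geometric_series; rewrite ger0_norm//; lra.
split=> // J.
(* Keeping the exact finite geometric sum on the right lets the induction close; the negative term
   is dropped only at the end. *)
have h n : `|series u (n + J)%N - series u J| <=
    3 / 2 * 3^-1 ^+ J - 3 / 2 * 3^-1 ^+ (n + J).
  elim: n => [|n IH]; first by rewrite add0n !subrr normr0.
  rewrite addSn seriesSr [_ + u _]addrC -addrA; apply: le_trans (ler_normD _ _) _.
  apply: le_trans (lerD (hu _) IH) _.
  by rewrite exprS; lra.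
have /cvg_lim <- // : `|series u n - series u J| @[n --> \oo] -->
    `|limn (series u) - series u J|.
  by apply: cvg_norm; apply: cvgB => //; exact: cvg_cst.
apply: limr_le.
  by apply: is_cvg_norm; apply: is_cvgB => //; exact: is_cvg_cst.
near=> n; have Jn : (J <= n)%N by near: n; exact: nbhs_infty_ge.
rewrite -(subnK Jn); apply: le_trans (h _) _.
by rewrite lerBlDr lerDl mulr_ge0 ?exprn_ge0//.
Unshelve. all: by end_near. Qed.

Lemma uniform_boundedness_c0 (b : nat -> nat -> R) :
  (forall n, exists M, abs_sum_le M (b n)) ->
  (forall y, y k @[k --> \oo] --> (0 : R) ->
     exists C : R, forall n, `|row_sum (b n) y| <= C) ->
  exists M, forall n, abs_sum_le M (b n).
Proof.
move=> hb hbnd; apply: contrapT => hM.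
(* The triple is (row index, cutoff, l^1 norm). If no row qualified at stage j, every norm would
   stay below the threshold [4 * j.+1%:R * 3 ^+ j], which would be a uniform bound. For a row above
   it, the cutoff exists because 3/4 of the norm is strictly below the limit of the partial sums. *)
have step (j : nat) : exists p : nat * nat * R,
    [/\ abs_sum_le p.2 (b p.1.1), 4 * j.+1%:R * 3 ^+ j <= p.2 &
       3 / 4 * p.2 <= \sum_(0 <= k < p.1.2) `|b p.1.1 k|].
  apply: contrapT => hno; apply: hM; exists (4 * j.+1%:R * 3 ^+ j) => n.
  have [M0 hM0] := hb n; have cn := is_cvg_abs_sum hM0.
  set B := limn (fun N => \sum_(0 <= k < N) `|b n k|).
  have hB : abs_sum_le B (b n).
    move=> N; apply: (@nondecreasing_cvgn_le R (fun N => \sum_(0 <= k < N) `|b n k|)) => //.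
    by apply/nondecreasing_seqP => q; rewrite big_nat_recr//= lerDl.
  have [leB N|ltB] := leP B (4 * j.+1%:R * 3 ^+ j); first exact: le_trans (hB N) leB.
  exfalso; apply: hno.
  have B0 : 0 < B by apply: le_lt_trans ltB; rewrite !mulr_ge0 ?exprn_ge0.
  have lt34 : 3 / 4 * B < B by lra.
  have [N _ /(_ N (leqnn N)) /ltW] := cvgr_gt _ cn _ lt34.
  by move=> hN; exists (n, N, B); split=> //=; exact: ltW.
have [p hp] := choice step.
pose b' j := b (p j).1.1; pose B j := (p j).2.
have hB j : abs_sum_le (B j) (b' j) by case: (hp j).
pose s j k := if (k < (p j).1.2)%N then Num.sg (b' j k) else 0 : R.
have s1 j k : `|s j k| <= 1.
  by rewrite /s; case: ifP => _; rewrite ?normr0 // normr_sg; case: (_ != _).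
pose L j := \sum_(0 <= k < (p j).1.2) `|b' j k|.
have sL j : row_sum (b' j) (s j) = L j.
  rewrite (@row_sum_finite _ _ (p j).1.2).
    apply: eq_big_nat => k /andP[_ kp].
    by rewrite /s kp mulrC -normrEsg.
  by move=> k pk; rewrite /s ltnNge pk mulr0.
(* The positive sign is kept if it already makes the pairing with row j at least
   [3^-1 ^+ j' * L j']; otherwise the sign is flipped. *)
pose xs := fix xs (j : nat) : nat -> R := if j is j'.+1 then
  let e : R := if 3^-1 ^+ j' * L j' <=
      `|row_sum (b' j') (fun k => 3^-1 ^+ j' * s j' k + xs j' k)|
    then 1 else -1 in
  fun k => e * 3^-1 ^+ j' * s j' k + xs j' k else fun=> 0.
have xsS j : exists2 e : R, `|e| = 1 &
    xs j.+1 = (fun k => e * 3^-1 ^+ j * s j k + xs j k) /\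
    ((e = 1 /\ 3^-1 ^+ j * L j <= `|row_sum (b' j) (fun k => 3^-1 ^+ j * s j k + xs j k)|)
     \/ (e = -1 /\ `|row_sum (b' j) (fun k => 3^-1 ^+ j * s j k + xs j k)| < 3^-1 ^+ j * L j)).
  rewrite /=; case: leP => h; [exists 1|exists (-1)]; rewrite ?normrN ?normr1//; split=> //.
    by left.
  by right.
(* At each fixed index k the increments telescope, so the limit x is the sum of a series dominated
   by powers of 1/3, with tails uniform in k. *)
pose u k j := xs j.+1 k - xs j k.
have xsE k J : series (u k) J = xs J k.
  by rewrite /series/= telescope_sumr//= subr0.
have u3 k j : `|u k j| <= 3^-1 ^+ j.
  rewrite /u; have [e e1 [-> _]] := xsS j.
  rewrite addrK !normrM e1 mul1r ger0_norm ?exprn_ge0//.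
  by rewrite ler_piMr ?exprn_ge0.
have geo k := third_geometric_cvg (u3 k).
pose x k := limn (series (u k)).
have xtail J k : `|x k - xs J k| <= 3 / 2 * 3^-1 ^+ J.
  by rewrite -xsE; exact: (geo k).2.
have xs_supp J : exists K, forall k, (K <= k)%N -> xs J k = 0.
  elim: J => [|J [K hK]]; first by exists 0%N.
  exists (maxn K (p J).1.2) => k; rewrite geq_max => /andP[Kk pk].
  have [e _ [-> _]] := xsS J.
  by rewrite hK// /s ltnNge pk mulr0 addr0.
have xs_bnd J : exists C : R, forall k, `|xs J k| <= C.
  elim: J => [|J [C hC]]; first by exists 0 => k /=; rewrite normr0.
  have [e e1 [-> _]] := xsS J.
  exists (3^-1 ^+ J + C) => k; apply: le_trans (ler_normD _ _) _; apply: lerD => //.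
  rewrite !normrM e1 mul1r ger0_norm ?exprn_ge0//.
  by rewrite ler_piMr ?exprn_ge0.
(* Each [xs J] has finite support and is uniformly within [3 / 2 * 3^-1 ^+ J] of x, so x is a
   uniform limit of finitely supported sequences. *)
have x0 : x k @[k --> \oo] --> (0 : R).
  apply/cvgrPdist_le => eps eps0.
  have c3 : 3 / 2 * 3^-1 ^+ J @[J --> \oo] --> (3 / 2 * 0 : R).
    apply: cvgM; first exact: cvg_cst.
    by apply: cvg_expr; rewrite ger0_norm//; lra.
  rewrite mulr0 in c3.
  have [J _ /(_ J (leqnn J)) hJ] := cvgr_lt _ c3 _ eps0.
  have [K hK] := xs_supp J.
  near=> k; rewrite sub0r normrN.
  have := xtail J k; rewrite hK; last by near: k; exact: nbhs_infty_ge.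
  by rewrite subr0 => /le_trans; apply; exact: ltW.
have [C hC] := hbnd x x0.
have x_bnd : exists C : R, forall k, `|x k| <= C.
  by exists (3/2) => k; have := xtail 0%N k; rewrite /= subr0 expr0 mulr1.
suff big j : j.+1%:R <= `|row_sum (b' j) x|.
  have := archi_boundP (le_trans (normr_ge0 _) (hC 0%N)).
  set q := Num.bound C => Cq.
  have := le_trans (big q) (hC _); rewrite leNgt => /negP; apply.
  by apply: lt_le_trans Cq _; rewrite ler_nat.
have [_ Bj Lj] := hp j; rewrite -/(L j) -/(B j) in Bj Lj.
have pw : 0 < 3^-1 ^+ j :> R by rewrite exprn_gt0.
have pw1 : 3^-1 ^+ j * (3 ^+ j) = 1 :> R by rewrite -exprMn mulVf// expr1n.
have hx : row_sum (b' j) x =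
    row_sum (b' j) (fun k => x k - xs j.+1 k) + row_sum (b' j) (xs j.+1).
  have -> : row_sum (b' j) x =
      row_sum (b' j) (fun k => 1 * (x k - xs j.+1 k) + xs j.+1 k).
    by congr row_sum; apply: funext => k; rewrite mul1r subrK.
  rewrite (row_sum_linear _ (hB j))//; first by rewrite mul1r.
  by exists (3 / 2 * 3^-1 ^+ j.+1) => k; exact: xtail.
have tailj : `|row_sum (b' j) (fun k => x k - xs j.+1 k)| <=
    B j * (3 / 2 * 3^-1 ^+ j.+1).
  exact: row_sum_le (hB j) (xtail j.+1).
have headj : 3^-1 ^+ j * L j <= `|row_sum (b' j) (xs j.+1)|.
  have lin e : row_sum (b' j) (fun k => e * 3^-1 ^+ j * s j k + xs j k) =
     e * 3^-1 ^+ j * L j + row_sum (b' j) (xs j).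
    by rewrite (row_sum_linear _ (hB j)) ?sL//; exists 1.
  have [e _ [-> [[-> h]|[-> h]]]] := xsS j.
    apply: le_trans h _; rewrite le_eqVlt; apply/orP; left; apply/eqP.
    by congr (`|row_sum _ _|); apply: funext => k; rewrite mul1r.
  (* Write c for [3^-1 ^+ j * L j] and v for the pairing of row j with [xs j]. The failed test gives
     c + v < c, so v is negative and |v - c| >= c. *)
  have -> := lin (-1).
  have := lin 1; rewrite mul1r => E; rewrite E in h.
  move: h; rewrite mulN1r mulNr ltr_norml => /andP[_ h]; rewrite ler_normr; apply/orP; right; lra.
have h3 : `|row_sum (b' j) (xs j.+1)| <=
    `|row_sum (b' j) x| + `|row_sum (b' j) (fun k => x k - xs j.+1 k)|.
  by apply: le_trans (ler_normB _ _); rewrite hx addrAC subrr add0r.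
(* Balance of constants, with P = 3^-j: the head is at least 3/4 of P * B and the tail at most 1/2
   of it, so 1/4 of P * B survives, and the threshold 4(j+1)3^j makes this at least j+1. *)
have : 3^-1 ^+ j * (3 / 4 * B j) <= 3^-1 ^+ j * L j by rewrite ler_pM2l.
have : 3^-1 ^+ j * (4 * j.+1%:R * 3 ^+ j) <= 3^-1 ^+ j * B j by rewrite ler_pM2l.
have -> : 3^-1 ^+ j * (4 * j.+1%:R * 3 ^+ j) = 4 * j.+1%:R * (3^-1 ^+ j * 3 ^+ j) :> R by ring.
rewrite pw1 mulr1 => h1 h2.
move: tailj; rewrite exprS.
move: h1 h2 h3 headj; set P := 3^-1 ^+ j; lra.
Unshelve. all: by end_near. Qed.

End ScalarRows.

(** * The filters behind the two notions of convergence *)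

Section IdealFilters.
Set Implicit Arguments.
Unset Strict Implicit.
Implicit Types I J : set (set nat).

(** [ideal_cvg I z eta] unfolds to convergence of z along this filter, which opens the general limit
    calculus. Testing the complement directly avoids the existential of [dual_filter]. *)
Definition ideal_filter I : set_system nat := [set P | I (~` P)].

(* [almost_cvg J sigma z eta] unfolds to the convergence of
   [q |-> shifted_mean sigma q.2 q.1 z] to [eta] along this filter. *)
Definition almost_filter J : set_system (nat * nat) :=
  [set P | exists2 S, dual_filter J S & forall n, S n -> forall nu, P (n, nu)].

Lemma ideal_filter_filter I : is_ideal I -> Filter (ideal_filter I).
Proof.
move=> hI; constructor.
- by rewrite /ideal_filter /= setCT; exact: ideal_finite.
- by move=> P Q hP hQ; rewrite /ideal_filter /= setCI; exact: ideal_setU.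
- by move=> P Q PQ hP; apply: (ideal_subset hI _ hP); exact: subsetC.
Qed.

Lemma almost_filter_filter J : is_ideal J -> Filter (almost_filter J).
Proof.
move=> hJ; constructor.
- by exists setT => //; exists set0; [exact: ideal_finite|rewrite setC0].
- move=> P Q [_ [S JS <-] hS] [_ [S' JS' <-] hS'].
  exists (~` (S `|` S')); first by exists (S `|` S') => //; exact: ideal_setU.
  by move=> n; rewrite setCU => -[Sn S'n] nu; split; [exact: hS|exact: hS'].
- by move=> P Q PQ [S JS hS]; exists S => // n Sn nu; apply: PQ; exact: hS.
Qed.

Lemma ideal_cvg_nbhs_infty (R : realType) I (y : nat -> R^o) (eta : R) :
  is_ideal I -> y k @[k --> \oo] --> eta -> ideal_cvg I y (eta : R^o).
Proof.
move=> hI yeta U /yeta [K _ hK]; apply: ideal_finite => //.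
apply: (@sub_finite_set _ _ `I_K); last exact: finite_II.
by move=> k /= nU; rewrite ltnNge; apply/negP => Kk; apply: nU; exact: hK.
Qed.

End IdealFilters.

(** * Reduction to matrix entries, and the calculus of scalar almost convergence *)

Section Entrywise.
Set Implicit Arguments.
Unset Strict Implicit.
Context {R : realType}.

Lemma bounded_fun_natP (V : normedModType R) (z : nat -> V) :
  bounded_fun z <-> exists C, forall n, `|z n| <= C.
Proof.
have PF := @globally_properfilter nat setT 0%N I.
split=> [/(ex_bound z) [C hC]|[C hC]].
  by exists C => n; exact: hC.
by apply/(ex_bound z); exists C => n _; exact: hC.
Qed.

Lemma entry_norm_le (m n : nat) (v : 'M[R]_(m, n)) i j : `|v i j| <= `|v|.
Proof.
by rewrite [leRHS]/Num.Def.normr /= mx_normrE; apply: (le_bigmax _ (fun ij => `|v ij.1 ij.2|) (i, j)).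
Qed.

Lemma norm_le_entries (m n : nat) (v : 'M[R]_(m, n)) C :
  0 <= C -> (forall i j, `|v i j| <= C) -> `|v| <= C.
Proof.
move=> C0 h; rewrite [leLHS]/Num.Def.normr /= mx_normrE; apply: bigmax_le => // -[i j] _.
Qed.

(** One direction is continuity of the coordinates; the other expands a matrix as a finite
    combination of the [delta_mx]. Stated for an arbitrary filter, it serves ideal, almost and
    ordinary convergence alike. *)
Lemma cvg_mxP (T : Type) (F : set_system T) (FF : Filter F) (m n : nat)
    (f : T -> 'M[R]_(m, n)) (v : 'M[R]_(m, n)) :
  f x @[x --> F] --> v <->
  forall i j, (f x i j : R^o) @[x --> F] --> (v i j : R^o).
Proof.
split=> [fv i j|h].
  apply: (@continuous_cvg _ _ _ F FF f (fun M : 'M[R]_(m, n) => M i j)) fv.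
  exact: coord_continuous.
rewrite [v]matrix_sum_delta.
have -> : f = fun x => \sum_(i < m) \sum_(j < n) f x i j *: delta_mx i j.
  by apply: funext => x; exact: matrix_sum_delta.
apply: cvg_big => [|i _]; first exact: add_continuous.
apply: cvg_big => [|j _]; first exact: add_continuous.
by apply: cvgZr_tmp; exact: h.
Qed.

Lemma shifted_mean_entry (sigma : nat -> nat) nu n (m p : nat)
    (z : nat -> 'M[R]_(m, p)) i j :
  shifted_mean sigma nu n z i j =
  shifted_mean sigma nu n (fun k => z k i j : R^o).
Proof. by rewrite /shifted_mean mxE summxE. Qed.

Lemma almost_cvg_mxP J sigma (hJ : is_ideal J) (m p : nat)
    (z : nat -> 'M[R]_(m, p)) v :
  almost_cvg J sigma z v <->
  forall i j, almost_cvg J sigma (fun k => z k i j : R^o) (v i j : R^o).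
Proof.
have FJ := almost_filter_filter hJ.
have P := cvg_mxP FJ (fun q => shifted_mean sigma q.2 q.1 z) v.
split=> [/P h i j|h].
  move=> U /(h i j) [S JS hS]; exists S => // n Sn nu.
  by have := hS n Sn nu; rewrite /= shifted_mean_entry.
apply: (P.2 _) => i j U /(h i j) [S JS hS]; exists S => // n Sn nu /=.
by rewrite shifted_mean_entry; exact: hS.
Qed.

Lemma ideal_cvg_mxP I (hI : is_ideal I) (m p : nat)
    (z : nat -> 'M[R]_(m, p)) v :
  ideal_cvg I z v <->
  forall i j, ideal_cvg I (fun k => z k i j : R^o) (v i j : R^o).
Proof. exact (cvg_mxP (ideal_filter_filter hI) z v). Qed.

Lemma almost_cvg_linear J sigma (hJ : is_ideal J) (z w : nat -> R^o)
    (c eta zeta : R^o) :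
  almost_cvg J sigma z eta -> almost_cvg J sigma w zeta ->
  almost_cvg J sigma (fun n => c * z n + w n : R^o) (c * eta + zeta : R^o).
Proof.
move=> hz hw; have FJ := almost_filter_filter hJ.
have h : c * shifted_mean sigma q.2 q.1 z + shifted_mean sigma q.2 q.1 w
    @[q --> almost_filter J] --> c * eta + zeta.
  by apply: cvgD => //; apply: cvgM => //; exact: cvg_cst.
move=> U /h [S JS hS]; exists S => // n Sn nu; have := hS n Sn nu.
rewrite /shifted_mean /= big_split/= -mulr_sumr.
by rewrite !/(_ *: _) /= mulrDr (mulrCA c).
Qed.

Lemma almost_cvg0 J sigma (hJ : is_ideal J) :
  almost_cvg J sigma (fun=> 0 : R^o) (0 : R^o).
Proof.
move=> U U0; exists setT.
  by exists set0; [exact: ideal_finite|rewrite setC0].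
move=> n _ nu; rewrite /shifted_mean big1 // scaler0.
exact: nbhs_singleton.
Qed.

Lemma almost_cvg_sum J sigma (hJ : is_ideal J) (T : Type) (s : seq T)
    (z : T -> nat -> R^o) (eta : T -> R^o) :
  (forall i, almost_cvg J sigma (z i) (eta i)) ->
  almost_cvg J sigma (fun n => \sum_(i <- s) z i n) (\sum_(i <- s) eta i).
Proof.
move=> h; elim: s => [|i s IH].
  rewrite big_nil; under [X in almost_cvg _ _ X _]eq_fun do rewrite big_nil.
  exact: almost_cvg0.
rewrite big_cons; under [X in almost_cvg _ _ X _]eq_fun do rewrite big_cons.
have := almost_cvg_linear hJ (c := 1) (h i) IH; rewrite mul1r.
by under [X in almost_cvg _ _ X _]eq_fun do rewrite mul1r.
Qed.

Lemma shifted_mean_le sigma nu n (z : nat -> R^o) C :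
  (forall k, `|z k| <= C) -> `|shifted_mean sigma nu n z| <= C.
Proof.
move=> hC; rewrite /shifted_mean normrZ ger0_norm ?invr_ge0//.
rewrite -ler_pdivlMl ?invr_gt0// invrK.
apply: le_trans (ler_norm_sum _ _ _) _.
apply: (@le_trans _ _ (\sum_(0 <= i < n.+1) C)); first by apply: ler_sum.
by rewrite sumr_const_nat subn0 mulr_natl.
Qed.

(** Averaging does not increase a uniform bound, so an error of e/2 on the sequence stays e/2 on all
    shifted means, whatever the shift; the other e/2 comes from the convergence of w. *)
Lemma almost_cvg_approx J sigma (hJ : is_ideal J) (z : nat -> R^o) (eta : R^o) :
  (forall e, 0 < e -> exists w : nat -> R^o,
     almost_cvg J sigma w eta /\ forall n, `|z n - w n| <= e) ->
  almost_cvg J sigma z eta.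
Proof.
move=> h; have FJ := almost_filter_filter hJ.
suff : shifted_mean sigma q.2 q.1 z @[q --> almost_filter J] --> (eta : R^o) by [].
apply/cvgrPdist_le => e e0.
have e20 : 0 < e / 2 by lra.
have [w [hw zw]] := h _ e20.
have : shifted_mean sigma q.2 q.1 w @[q --> almost_filter J] --> (eta : R^o) by [].
move=> /cvgrPdist_le /(_ _ e20); apply: filterS => q /= hq.
have := shifted_mean_le sigma q.2 q.1 (z := fun n => z n - w n : R^o) zw.
have -> : shifted_mean sigma q.2 q.1 (fun n => z n - w n : R^o) =
    shifted_mean sigma q.2 q.1 z - shifted_mean sigma q.2 q.1 w.
  by rewrite /shifted_mean sumrB scalerBr.
set a := shifted_mean _ _ _ _ in hq *; set b := shifted_mean _ _ _ _ => hab.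
have -> : eta - b = (eta - a) - (b - a) by rewrite opprB addrA subrK.
apply: le_trans (ler_normB _ _) _; lra.
Qed.

End Entrywise.

(** * Sufficiency for one family of scalar rows *)

Section Sufficiency.
Set Implicit Arguments.
Unset Strict Implicit.
Context {R : realType}.
Variables (I J : set (set nat)) (hI : is_ideal I) (hJ : is_ideal J).
Variables (sigma : nat -> nat) (M : R) (b : nat -> nat -> R).
Hypothesis hM : forall n, abs_sum_le M (b n).
Implicit Types y w : nat -> R.

Lemma almost_cvg_row_linear y w (c eta zeta : R) :
  (exists C : R, forall k, `|y k| <= C) -> (exists C : R, forall k, `|w k| <= C) ->
  almost_cvg J sigma (fun n => row_sum (b n) y : R^o) (eta : R^o) ->
  almost_cvg J sigma (fun n => row_sum (b n) w : R^o) (zeta : R^o) ->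
  almost_cvg J sigma (fun n => row_sum (b n) (fun k => c * y k + w k) : R^o)
    (c * eta + zeta : R^o).
Proof.
move=> yb wb hy hw; have := almost_cvg_linear hJ (c := c) hy hw.
by under eq_fun do rewrite -(row_sum_linear _ (hM _) yb wb).
Qed.

Hypothesis hE : forall E, I E ->
  almost_cvg J sigma (fun n => row_sum (b n) \1_E : R^o) (0 : R^o).

Lemma indic_bounded (E : set nat) : exists C : R, forall k, `|\1_E k| <= C.
Proof. by exists 1 => k; rewrite indicE; case: (_ \in _); rewrite ?normr1 ?normr0. Qed.

(* Subtracting +-C/2 on the positive and nonpositive parts of E halves the bound on y. *)
Lemma simple_approx (p : nat) (C : R) y E : I E -> (forall k, `|y k| <= C) ->
  (forall k, ~ E k -> y k = 0) ->
  exists w, [/\ exists D : R, forall k, `|w k| <= D,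
    almost_cvg J sigma (fun n => row_sum (b n) w : R^o) (0 : R^o) &
    forall k, `|y k - w k| <= 2^-1 ^+ p * C].
Proof.
move=> IE; elim: p C y => [|p IH] C y hC y0.
  (* With no halving done yet, the zero sequence approximates y within C. *)
  exists (fun=> 0); split.
  - by exists 0 => k; rewrite normr0.
  - have -> : (fun n => row_sum (b n) (fun=> 0)) = (fun=> 0 : R^o).
      by apply: funext => n; rewrite (@row_sum_finite _ _ _ 0) ?big_geq// => k; rewrite mulr0.
    exact: almost_cvg0.
  - by move=> k; rewrite subr0 expr0 mul1r.
pose E1 := E `&` [set k | 0 < y k]; pose E2 := E `&` [set k | y k <= 0].
have IE1 : I E1 by apply: ideal_subset IE => // k [].
have IE2 : I E2 by apply: ideal_subset IE => // k [].
pose y' k := y k - (C / 2 * \1_E1 k + - (C / 2) * \1_E2 k).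
have [||w [wb hw yw]] := IH (C / 2) y'.
- move=> k; have := hC k; rewrite ler_norml => /andP[hl hr].
  rewrite /y' ler_norml !indicE.
  have [Ek|nEk] := pselect (E k); last first.
    by rewrite !memNset ?y0//; [|by case|by case]; apply/andP; split; lra.
  have [yp|yn] := ltP 0 (y k).
    rewrite mem_set// memNset; last by move=> [_ /=]; lra.
    rewrite mulr1n mulr0n.
    by apply/andP; split; lra.
  rewrite memNset; last by move=> [_ /=]; lra.
  by rewrite mem_set// mulr1n mulr0n; apply/andP; split; lra.
- by move=> k nEk; rewrite /y' !indicE !memNset ?y0//; [lra|by case|by case].
exists (fun k => C / 2 * \1_E1 k + (- (C / 2) * \1_E2 k + w k)).
have [D hD] := wb; have [D1 hD1] := indic_bounded E1; have [D2 hD2] := indic_bounded E2.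
have wb' : exists D : R, forall k, `|- (C / 2) * \1_E2 k + w k| <= D.
  exists (`|- (C / 2)| * D2 + D) => k; apply: le_trans (ler_normD _ _) _.
  by apply: lerD => //; rewrite normrM ler_wpM2l.
split.
- have [D' hD'] := wb'.
  exists (`|C / 2| * D1 + D') => k; apply: le_trans (ler_normD _ _) _.
  by apply: lerD => //; rewrite normrM ler_wpM2l.
- have := almost_cvg_row_linear (c := C / 2) (indic_bounded E1) wb' (hE IE1)
    (almost_cvg_row_linear (c := - (C / 2)) (indic_bounded E2) wb (hE IE2) hw).
  by rewrite !mulr0 !addr0.
- move=> k; have -> : y k - (C / 2 * \1_E1 k + (- (C / 2) * \1_E2 k + w k)) =
      y' k - w k by rewrite /y'; ring.
  by apply: le_trans (yw k) _; rewrite exprS; lra.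
Qed.

Lemma almost_cvg_row_null y C : (forall k, `|y k| <= C) ->
  ideal_cvg I (y : nat -> R^o) (0 : R^o) ->
  almost_cvg J sigma (fun n => row_sum (b n) y : R^o) (0 : R^o).
Proof.
move=> hC hy; have M0 := abs_sum_le_ge0 (hM 0%N).
have C0 : 0 <= C := le_trans (normr_ge0 _) (hC 0%N).
apply: (almost_cvg_approx hJ) => e e0.
(* One d pays for cutting y down to E, the other for the simple approximation on E. The row sums
   then err by at most M * (2 * d) = M * e / (M + 1) <= e, and M + 1 stays positive even when M =
   0. *)
pose d := e / (M + 1) / 2; have d0 : 0 < d by rewrite !divr_gt0//; lra.
pose E := [set k | ~ ball (0 : R^o) d (y k)].
have IE : I E by apply: hy; exact: nbhsx_ballx.
pose yE k := y k * \1_E k.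
have yEC k : `|yE k| <= C.
  rewrite /yE indicE; case: (_ \in _); rewrite ?mulr1 ?mulr0 ?normr0//.
have yE0 k : ~ E k -> yE k = 0 by move=> nE; rewrite /yE indicE memNset// mulr0.
have c2 : 2^-1 ^+ p * C @[p --> \oo] --> (0 * C : R).
  apply: cvgM; last exact: cvg_cst.
  by apply: cvg_expr; rewrite ger0_norm//; lra.
rewrite mul0r in c2.
have [p _ /(_ p (leqnn p)) /= hp] := cvgr_lt _ c2 _ d0.
have [w [wb hw yw]] := simple_approx p IE yEC yE0.
exists (fun n => row_sum (b n) w); split => // n.
have -> : row_sum (b n) y - row_sum (b n) w =
    row_sum (b n) (fun k => -1 * w k + y k).
  by rewrite (row_sum_linear _ (hM n))//; [lra|exists C].
apply: (@le_trans _ _ (M * (2 * d))).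
  apply: row_sum_le => // k.
  have -> : -1 * w k + y k = (y k - yE k) + (yE k - w k) by ring.
  apply: le_trans (ler_normD _ _) _.
  have : `|y k - yE k| <= d.
    rewrite /yE indicE; have [Ek|nEk] := pselect (E k).
      by rewrite mem_set// mulr1 subrr normr0 ltW.
    rewrite memNset// mulr0 subr0; apply: ltW.
    by move/contrapT: nEk; rewrite /ball /= sub0r normrN.
  have := yw k; lra.
rewrite (_ : 2 * d = e / (M + 1)); last by rewrite /d; field; lra.
by rewrite mulrA ler_pdivrMr; [nra|lra].
Qed.

(** Split y as eta times the constant sequence 1 plus an I-null remainder: the former contributes t
    * eta, the latter 0. *)
Lemma almost_cvg_row (t eta : R) y : (exists C : R, forall k, `|y k| <= C) ->
  almost_cvg J sigma (fun n => row_sum (b n) (fun=> 1) : R^o) (t : R^o) ->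
  ideal_cvg I (y : nat -> R^o) (eta : R^o) ->
  almost_cvg J sigma (fun n => row_sum (b n) y : R^o) (t * eta : R^o).
Proof.
move=> [C hC] ht hy; have FI := ideal_filter_filter hI.
have one : exists C : R, forall k : nat, `|(fun=> 1) k : R| <= C by exists 1 => k; rewrite normr1.
have hC' k : `|y k - eta| <= C + `|eta|.
  by apply: le_trans (ler_normB _ _) _; exact: lerD.
have hy' : ideal_cvg I (fun k => y k - eta : R^o) (0 : R^o).
  have : y k - eta @[k --> ideal_filter I] --> eta - eta.
    by apply: cvgB; [exact: hy|exact: cvg_cst].
  by rewrite subrr.
have := almost_cvg_row_linear (c := eta) one (ex_intro _ _ hC') ht (almost_cvg_row_null hC' hy').
rewrite addr0 [eta * t]mulrC /=.
have -> // : (fun k => eta * 1 + (y k - eta)) = y.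
by apply: funext => k; rewrite mulr1 addrC subrK.
Qed.

End Sufficiency.

(** * Passage between operator rows and scalar rows *)

Section MatrixRows.
Set Implicit Arguments.
Unset Strict Implicit.
Context {R : realType}.

(** The terms are nonnegative, so each extended-real series dominates its partial sums and is their
    limit. This trades K1 for a real bound on finite sums. *)
Lemma ereal_sup_series_ltyP (u : nat -> nat -> R) (u0 : forall n k, 0 <= u n k) :
  (ereal_sup [set (\sum_(0 <= k <oo) (u n k)%:E)%E | n in [set: nat]] < +oo)%E <->
  exists M, forall n N, \sum_(0 <= k < N) u n k <= M.
Proof.
split=> [|[M hM]].
  set S := ereal_sup _ => Soo.
  have hS n N : ((\sum_(0 <= k < N) u n k)%:E <= S)%E.
    rewrite -sumEFin; apply: le_trans (nneseries_lim_ge N _) _.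
      by move=> k _ _; rewrite lee_fin.
    by apply: ereal_sup_ubound; exists n.
  have S0 : (0 <= S)%E by apply: le_trans (hS 0%N 0%N); rewrite big_geq.
  exists (fine S) => n N; rewrite -lee_fin fineK//.
  by rewrite ge0_fin_numE.
apply: (@le_lt_trans _ _ M%:E); last exact: ltry.
apply: ge_ereal_sup => _ [n _ <-]; apply: lime_le.
  by apply: is_cvg_nneseries => k _ _; rewrite lee_fin.
by apply: nearW => N; rewrite sumEFin lee_fin.
Qed.

Context {d m : nat}.
Variables (a : nat -> nat -> 'M[R]_(m, d)) (A : nat -> nat -> {linear 'cV[R]_d -> 'cV[R]_m}).
Hypothesis ha : forall n k (x : 'cV[R]_d), A n k x = a n k *m x.

(** Coordinate i of each partial sum is a finite sum over j of scalar partial sums, so the limit in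
    N passes through the sum over columns. *)
Lemma is_cvg_opmx M C n (x : nat -> 'cV[R]_d) :
  (forall i j, abs_sum_le M (fun k => a n k i j)) ->
  (forall i j k, `|x k i j| <= C) ->
  cvgn (series (fun k => A n k (x k))) /\
  forall i, opmx_apply A x n i ord0 =
    \sum_(j < d) row_sum (fun k => a n k i j) (fun k => x k j ord0).
Proof.
move=> hM hC.
have h : series (fun k => A n k (x k)) @ \oo -->
   (\col_i \sum_(j < d) row_sum (fun k => a n k i j) (fun k => x k j ord0)).
  apply/cvg_mxP => i j; rewrite mxE (ord1 j).
  have -> : (fun N => series (fun k => A n k (x k)) N i ord0) =
      (fun N => \sum_(l < d) \sum_(0 <= k < N) a n k i l * x k l ord0).
    apply: funext => N; rewrite /series /= summxE exchange_big/=.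
    by apply: eq_bigr => k _; rewrite ha mxE.
  apply: cvg_big => [|l _]; first exact: add_continuous.
  exact: (is_cvg_row (hM i l) (fun k => hC l ord0 k)).
split; first by apply/cvg_ex; eexists; exact: h.
by move=> i; rewrite /opmx_apply (cvg_lim _ h)// mxE.
Qed.

(** Necessity is tested on sequences living on a single basis vector: feeding
    [y k *: delta_mx j ord0] and reading coordinate i isolates the scalar row of entries (i, j). *)
Lemma almost_regular_entry (I J : set (set nat)) (hI : is_ideal I) (hJ : is_ideal J) sigma
    (t : 'M[R]_(m, d)) (T : {linear 'cV[R]_d -> 'cV[R]_m})
    (ht : forall x : 'cV[R]_d, T x = t *m x) i j (y : nat -> R) eta :
  almost_regular I J sigma A T ->
  (exists C : R, forall k, `|y k| <= C) -> ideal_cvg I (y : nat -> R^o) (eta : R^o) ->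
  [/\ forall n, cvgn (fun N => \sum_(0 <= k < N) a n k i j * y k),
      exists C : R, forall n, `|row_sum (fun k => a n k i j) y| <= C &
      almost_cvg J sigma (fun n => row_sum (fun k => a n k i j) y : R^o)
        (t i j * eta : R^o)].
Proof.
move=> [hdom hreg] [C hC] hy; have FI := ideal_filter_filter hI.
pose x k : 'cV[R]_d := y k *: delta_mx j ord0.
have xeta : ideal_cvg I x (eta *: delta_mx j ord0).
  have : y k *: (delta_mx j ord0 : 'cV[R]_d) @[k --> ideal_filter I] -->
     eta *: (delta_mx j ord0 : 'cV[R]_d) by apply: cvgZr_tmp; exact: hy.
  exact.
have xc : bounded_ideal_cvg_seq I x.
  split; last by exists (eta *: delta_mx j ord0).
  apply/bounded_fun_natP; exists (C * `|delta_mx j ord0 : 'cV[R]_d|) => k.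
  by rewrite normrZ ler_wpM2r.
have entry (s : 'M[R]_(m, d)) c : (s *m (c *: delta_mx j ord0 : 'cV[R]_d)) i ord0 = s i j * c.
  by rewrite -scalemxAr -colE !mxE mulrC.
have cvgi n : (\sum_(0 <= k < N) a n k i j * y k) @[N --> \oo] -->
    opmx_apply A x n i ord0.
  have /cvg_mxP/(_ i ord0) := hdom x xc n.
  apply: cvg_trans; apply: near_eq_cvg; apply: nearW => N.
  rewrite /series /= summxE; apply: eq_bigr => k _.
  by rewrite ha entry.
have rowE n : row_sum (fun k => a n k i j) y = opmx_apply A x n i ord0.
  exact: cvg_lim (cvgi n).
have [[/bounded_fun_natP[D hD] _] /(_ _ xeta)/(almost_cvg_mxP _ hJ)/(_ i ord0) hlim] :=
  hreg x xc.
split.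
- by move=> n; apply/cvg_ex; eexists; exact: cvgi.
- by exists D => n; rewrite rowE; exact: le_trans (entry_norm_le _ _ _) (hD n).
- by under eq_fun do rewrite rowE; rewrite -entry -ht.
Qed.

End MatrixRows.

(** * Uniform l^1 bounds for scalar rows *)

Lemma abs_sum_le_entries {R : realType} {m d : nat} (v : nat -> 'M[R]_(m, d)) M i j :
  (forall N, \sum_(0 <= k < N) \sum_(i < m) \sum_(j < d) `|v k i j| <= M) ->
  abs_sum_le M (fun k => v k i j).
Proof.
move=> h N; apply: le_trans (h N); apply: ler_sum => k _.
rewrite (bigD1 i)//= (bigD1 j)//= -addrA lerDl addr_ge0//.
  by apply: sumr_ge0.
by apply: sumr_ge0 => ? _; apply: sumr_ge0.
Qed.

(* Applied to the truncated rows, the uniform boundedness principle first gives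
   absolute summability of each row (the beta-dual of c_0 is l^1). *)
Lemma c0_rows_bounded {R : realType} (b : nat -> nat -> R) :
  (forall y, y k @[k --> \oo] --> (0 : R) ->
     (forall n, cvgn (fun N => \sum_(0 <= k < N) b n k * y k)) /\
     exists C : R, forall n, `|row_sum (b n) y| <= C) ->
  exists M, forall n, abs_sum_le M (b n).
Proof.
move=> h; apply: uniform_boundedness_c0 => [n|y /h[]//].
(* For fixed n, truncation N pairs with y to give the N-th partial sum of row n; these are bounded
   in N because the row converges at y. *)
pose b' N k := if (k < N)%N then b n k else 0.
have [N||M hM] := @uniform_boundedness_c0 R b'.
- exists (\sum_(0 <= k < N) `|b n k|) => K.
  have [KN|NK] := leqP K N.
    apply: (@le_trans _ _ (\sum_(0 <= k < K) `|b n k|)).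
      by apply: ler_sum => k _; rewrite /b'; case: ifP; rewrite ?normr0.
    by rewrite (@big_cat_nat _ _ _ K _ N)//= lerDl sumr_ge0.
  rewrite (@big_cat_nat _ _ _ N)//= ?(ltnW NK)//.
  rewrite [X in _ + X]big_nat_cond [X in _ + X]big1 ?addr0; last first.
    by move=> k; rewrite andbT => /andP[Nk _]; rewrite /b' ltnNge Nk normr0.
  by apply: ler_sum => k _; rewrite /b'; case: ifP; rewrite ?normr0.
- move=> y /h[/(_ n) cy _].
  have /bounded_fun_natP[C hC] := @cvg_seq_bounded R R^o _ cy.
  exists C => N; rewrite (@row_sum_finite _ _ _ N).
    apply: le_trans (hC N); rewrite le_eqVlt; apply/orP; left; apply/eqP; congr (`|_|).
    by apply: eq_big_nat => k /andP[_ kN]; rewrite /b' kN.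
  by move=> k Nk; rewrite /b' ltnNge Nk mul0r.
exists M => N; apply: le_trans (hM N N).
by apply: ler_sum_nat => k /andP[_ kN]; rewrite /b' kN.
Qed.

(** * Assembly of the equivalence *)

Theorem theorem2p9 (R : realType) (d m : nat) (hd : (1 <= d)%N) (hm : (1 <= m)%N)
    (A : nat -> nat -> {linear 'cV[R]_d -> 'cV[R]_m})
    (hA : forall n k, bounded_fun_norm (A n k))
    (T : {linear 'cV[R]_d -> 'cV[R]_m}) (hT : bounded_fun_norm T)
    (sigma : nat -> nat) (sigma_inj : injective sigma)
    (sigma_nper : without_periodic_points sigma)
    (I J : set (set nat)) (hI : is_ideal I) (hJ : is_ideal J)
    (hJcg : countably_generated J)
    (a : nat -> nat -> 'M[R]_(m, d)) (t : 'M[R]_(m, d))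
    (ha : forall n k (x : 'cV[R]_d), A n k x = a n k *m x)
    (ht : forall x : 'cV[R]_d, T x = t *m x) :
  almost_regular I J sigma A T <->
  [/\ (* K1 *)
      (ereal_sup [set (\sum_(0 <= k <oo)
                        (\sum_(i < m) \sum_(j < d) `|a n k i j|)%:E)%E
                  | n in [set: nat]] < +oo)%E,
      (* K2 *)
      forall (i : 'I_m) (j : 'I_d),
        almost_cvg J sigma
          (fun n => limn (fun N => \sum_(0 <= k < N) a n k i j) : R^o)
          (t i j : R^o) &
      (* K3 *)
      forall (i : 'I_m) (j : 'I_d) (E : set nat), I E ->
        almost_cvg J sigma
          (fun n => limn (fun N => \sum_(0 <= k < N | k \in E) a n k i j) : R^o)
          (0 : R^o)].
Proof.
have a0 n k : 0 <= \sum_(i < m) \sum_(j < d) `|a n k i j|.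
  by apply: sumr_ge0 => ? _; apply: sumr_ge0.
have row1E i j : (fun n => limn (fun N => \sum_(0 <= k < N) a n k i j)) =
    (fun n => row_sum (fun k => a n k i j) (fun=> 1)).
  apply: funext => n; congr (lim (_ @ \oo)); apply: funext => N.
  by apply: eq_bigr => k _; rewrite mulr1.
have rowIE i j (E : set nat) :
    (fun n => limn (fun N => \sum_(0 <= k < N | k \in E) a n k i j)) =
    (fun n => row_sum (fun k => a n k i j) \1_E).
  apply: funext => n; congr (lim (_ @ \oo)); apply: funext => N.
  rewrite big_mkcond; apply: eq_bigr => k _.
  by rewrite indicE; case: (_ \in _); rewrite ?mulr1 ?mulr0.
have one : exists C : R, forall k : nat, `|(fun=> 1) k : R| <= C.
  by exists 1 => k; rewrite normr1.
split=> [hreg|[/(ereal_sup_series_ltyP a0)[M hM] K2 K3]].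
  have entry i j y eta := @almost_regular_entry _ _ _ _ _ ha _ _ hI hJ sigma _ _ ht i j y eta hreg.
  split.
  (* Null sequences are I-convergent to 0, so the [c_0] principle bounds each entry separately;
     there are finitely many entries, and their bounds add up. *)
  - have /choice[M hM] : forall ij : 'I_m * 'I_d, exists M,
        forall n, abs_sum_le M (fun k => a n k ij.1 ij.2).
      move=> [i j]; apply: c0_rows_bounded => y y0.
      have /bounded_fun_natP yb := @cvg_seq_bounded R R^o y (cvgP _ y0).
      by have [] := entry i j y 0 yb (ideal_cvg_nbhs_infty hI y0).
    apply/(ereal_sup_series_ltyP a0).
    exists (\sum_(i < m) \sum_(j < d) M (i, j)) => n N.
    rewrite exchange_big; apply: ler_sum => i _.
    rewrite exchange_big; apply: ler_sum => j _.
    exact: hM (i, j) n N.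
  - move=> i j; rewrite row1E.
    have [] := entry i j (fun=> 1) 1 one; last by rewrite mulr1.
    exact: ideal_cvg_nbhs_infty hI (cvg_cst _).
  - move=> i j E IE; rewrite rowIE.
    have [] := entry i j \1_E 0 (indic_bounded E); last by rewrite mulr0.
    (* The indicator of E is I-null: it can leave a neighbourhood of 0 only at points of E. *)
    move=> U U0; apply: (ideal_subset hI _ IE) => k /= nU.
    apply: contrapT => nE; apply: nU; rewrite indicE memNset//.
    exact: nbhs_singleton.
have hMij n i j := abs_sum_le_entries i j (hM n).
have bnd (x : nat -> 'cV[R]_d) : bounded_fun x -> exists C : R, forall i j k, `|x k i j : R| <= C.
  move=> /(@bounded_fun_natP R 'cV[R]_d)[C hC]; exists C => i j k.
  exact: le_trans (entry_norm_le _ _ _) (hC k).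
split=> [x [/bnd[C hC] _] n|x [/bnd[C hC] xcvg]].
  exact: (is_cvg_opmx ha (hMij n) hC).1.
have applyE n := (is_cvg_opmx ha (hMij n) hC).2.
have main eta : ideal_cvg I x eta -> almost_cvg J sigma (opmx_apply A x) (T eta).
  move=> /(ideal_cvg_mxP hI) xeta; apply/(almost_cvg_mxP _ hJ) => i c.
  rewrite (ord1 c) ht mxE; under eq_fun do rewrite applyE.
  suff h j : almost_cvg J sigma
      (fun n => row_sum (fun k => a n k i j) (fun k => x k j ord0) : R^o)
      (t i j * eta j ord0 : R^o) by exact: (almost_cvg_sum hJ h).
  apply: (almost_cvg_row hI hJ (fun n => hMij n i j)).
  - by move=> E IE; rewrite -rowIE; exact: K3.
  - by exists C => k; exact: hC.
  - by rewrite -row1E; exact: K2.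
  - exact: xeta.
split; last exact: main.
split; last by have [eta /main h] := xcvg; exists (T eta).
apply/bounded_fun_natP; exists (\sum_(j < d) M * C) => n.
have le_entry i : `|opmx_apply A x n i ord0| <= \sum_(j < d) M * C.
  rewrite applyE; apply: le_trans (ler_norm_sum _ _ _) _; apply: ler_sum => j _.
  by apply: row_sum_le => [|k]; [exact: hMij|exact: hC].
apply: norm_le_entries => [|i c]; last by rewrite (ord1 c).
(* Nonnegativity of the bound is read off from an actual coordinate, which exists because m >= 1. *)
by apply: le_trans (le_entry (Ordinal hm)).
Qed.
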